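(* Let $X$ be a completely regular space which is locally null with respect to an ideal $\mathscr{I}$ of an upper semi-lattice $(\mathscr{L},\subseteq)$, where $\mathscr{L}\subseteq\mathscr{P}(X)$. The following are equivalent: (1) $\lambda_{\mathscr I} X$ is compact. (2) $\mathscr{I}$ is non-proper. (3) $C^{\mathscr I}_0(X)$ is unital. (4) $C^{\mathscr I}_{00}(X)$ is unital.
   Context: A space is a topological space; completely regular spaces are taken to be Hausdorff, and $\beta X$ is the Stone–Čech compactification of $X$, containing $X$ as a dense subspace. $\mathscr{P}(X)$ is the power set of $X$. $C_b(X)$ is the algebra of continuous bounded $f:X\to\mathbb{R}$ with pointwise operations; $\mathrm{coz}(f)=X\setminus f^{-1}(0)$, $\mathrm{supp}(f)=\mathrm{cl}_X\mathrm{coz}(f)$, and $\mathrm{Coz}(X)$ is the set of all cozero-sets of continuous real-valued functions on $X$. An upper semi-lattice is a partially ordered set in which any two elements $A,B$ have a least upper bound $A\vee B$. For $\mathscr{L}\subseteq\mathscr{P}(X)$ ordered by inclusion, $A\vee B$ is computed in $\mathscr{L}$ and need not equal $A\cup B$. An ideal $\mathscr{I}$ in $(\mathscr{L},\subseteq)$ is a non-empty subset of $\mathscr{L}$ such that $A\vee B\in\mathscr{I}$ whenever $A,B\in\mathscr{I}$, and $T\in\mathscr{I}$ whenever $T\in\mathscr{L}$ and $T\subseteq A$ for some $A\in\mathscr{I}$. Elements of $\mathscr{I}$ are called null; $\mathscr{I}$ is non-proper if $X\in\mathscr{I}$. A neighborhood of a set $A$ in $X$ is a set $U\subseteq X$ with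 $A\subseteq\mathrm{int}_XU$. $X$ is locally null (with respect to $\mathscr{I}$) if every point of $X$ has a null neighborhood in $X$. $C^{\mathscr I}_{00}(X)=\{f\in C_b(X):\mathrm{supp}(f)\text{ has a null neighborhood in }X\}$. $C^{\mathscr I}_0(X)=\{f\in C_b(X):|f|^{-1}([1/n,\infty))\text{ has a null neighborhood in }X\text{ for each positive integer }n\}$. $\lambda_{\mathscr I} X=\bigcup\{\mathrm{int}_{\beta X}\mathrm{cl}_{\beta X}C: C\in\mathrm{Coz}(X)\text{ and }\mathrm{cl}_XC\text{ has a null neighborhood in }X\}$, considered as a subspace of $\beta X$. An algebra is unital if it has a multiplicative unit element. *)

(* Defs.v *)
From HB Require Import structures.
From mathcomp Require Import all_boot all_order all_algebra.
From mathcomp Require Import all_classical all_reals.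
From mathcomp Require Import topology normedtype.

Set Implicit Arguments.
Unset Strict Implicit.
Unset Printing Implicit Defensive.

Import Order.TTheory GRing.Theory Num.Theory.
Import numFieldNormedType.Exports.

Local Open Scope classical_set_scope.
Local Open Scope ring_scope.

Section StoneCech.
Context {X bX : topologicalType}.

Definition embedding (e : X -> bX) : Prop :=
  injective e /\
  (forall U : set X, open U <-> exists2 V : set bX, open V & e @^-1` V = U).

(* The pair (bX, e) is determined by X up to a unique homeomorphism commuting
   with the embeddings; its existence is [stone_cech_exists] below. *)
Definition stone_cech (e : X -> bX) : Prop :=
  [/\ compact [set: bX], hausdorff_space bX, embedding e, dense (range e) &
   forall (K : topologicalType) (f : X -> K),
     compact [set: K] -> hausdorff_space K -> continuous f ->
     exists2 g : bX -> K, continuous g & forall x, g (e x) = f x].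

End StoneCech.

Section Ideals.
Context {X : Type}.
Implicit Types (L I : set (set X)) (A B S T : set X).

(* S is the least upper bound of A and B computed in (L, `<=`); it contains
   A `|` B but may be larger. *)
Definition is_join L A B S : Prop :=
  [/\ L S, A `<=` S, B `<=` S &
   forall T, L T -> A `<=` T -> B `<=` T -> S `<=` T].

Definition upper_semilattice L : Prop :=
  forall A B, L A -> L B -> exists S, is_join L A B S.

Definition ideal L I : Prop :=
  [/\ I `<=` L, I !=set0,
   forall A B S, I A -> I B -> is_join L A B S -> I S &
   forall A T, I A -> L T -> T `<=` A -> I T].

End Ideals.

Section NullNeighborhoods.
Context {X : topologicalType} (I : set (set X)).

(* The neighborhood U itself need not be open. *)
Definition has_null_nbhd (A : set X) : Prop :=
  exists2 U : set X, I U & A `<=` U°.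

Definition locally_null : Prop := forall x : X, has_null_nbhd [set x].

End NullNeighborhoods.

Section FunctionAlgebras.
Context {R : realType} {X : topologicalType}.
Implicit Types (f : X -> R) (I : set (set X)).

Definition Cb : set (X -> R) := [set f | continuous f /\ bounded_fun f].

Definition coz f : set X := ~` (f @^-1` [set 0]).

Definition supp f : set X := closure (coz f).

Definition Coz : set (set X) := [set coz f | f in [set f | continuous f]].

Definition C00 I : set (X -> R) := Cb `&` [set f | has_null_nbhd I (supp f)].

Definition C0 I : set (X -> R) := Cb `&`
  [set f | forall n : nat, (0 < n)%N ->
     has_null_nbhd I [set x | n%:R^-1 <= `|f x|]].

(* The unit must lie in A but is not required to be the constant function 1,
   nor to be nonzero. *)
Definition unital (A : set (X -> R)) : Prop :=
  exists2 u, A u & forall f, A f -> u \* f = f /\ f \* u = f.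

End FunctionAlgebras.

Arguments Coz R X : clear implicits.
Arguments C00 R {X} I.
Arguments C0 R {X} I.

Definition lambda (R : realType) (X bX : topologicalType) (e : X -> bX)
    (I : set (set X)) : set bX :=
  \bigcup_(C in [set C | Coz R X C /\ has_null_nbhd I (closure C)])
    (closure (e @` C))°.

(* The closure of the image of X in the cube indexed by the continuous functions
   from X to [0, 1]. *)
Section StoneCechExists.
Context (R : realType) (X : topologicalType).

Let cube_index : Type :=
  {classic {f : X -> R | continuous f /\ range f `<=` `[0, 1]}}.

Let cube : topologicalType := prod_topology (fun _ : cube_index => R).

Let ev : X -> cube := join_product (fun i : cube_index => sval i).

Let beta : topologicalType := set_type (closure (range ev)).

Let ev_beta (x : X) : beta :=
  exist _ (ev x) (mem_set (subset_closure (ex_intro2 _ _ x Logic.I erefl))).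

Let val_beta (p : beta) : cube := \val p.

Let val_beta_continuous : continuous val_beta.
Proof. exact: initial_continuous. Qed.

Let coord_continuous (i : cube_index) :
  continuous (fun p : beta => val_beta p i).
Proof.
move=> p A nA.
have := @proj_continuous cube_index (fun=> R) i (val_beta p) A nA.
exact: val_beta_continuous.
Qed.

Let beta_hausdorff : hausdorff_space beta.
Proof.
have cube_hausdorff : hausdorff_space cube.
  exact: (@hausdorff_product cube_index (fun=> R) (fun=> @Rhausdorff R)).
move=> p q pq; apply: eq_sig_hprop => //; apply: cube_hausdorff => A B nA nB.
have [r [Ar Br]] := pq _ _ (@val_beta_continuous p A nA) (@val_beta_continuous q B nB).
by exists (sval r).
Qed.

Let beta_compact : compact [set: beta].
Proof.
have cube_hausdorff : hausdorff_space cube.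
  exact: (@hausdorff_product cube_index (fun=> R) (fun=> @Rhausdorff R)).
pose Q : set cube := [set f | forall i, `[0, 1]%classic (f i)].
have cQ : compact Q.
  exact: (@tychonoff cube_index (fun=> R) (fun=> `[0, 1]%classic)
    (fun=> @segment_compact _ _ _)).
have cI : compact (closure (range ev)).
  apply: (subclosed_compact _ cQ); first exact: closed_closure.
  rewrite [X in _ `<=` X](closure_id _).1; last exact: compact_closed.
  by apply: closureS => _ [x _ <-] i; case: (svalP i) => _; apply; exists x.
move=> F FF _.
have [|q [clq Fq]] := cI (val_beta @ F).
  apply: (@filterS _ F _ setT); last exact: filterT.
  by move=> p _; exact: set_mem (valP p).
exists (exist _ q (mem_set clq)); split=> // A B FA.
rewrite nbhsE => -[_ [[V oV <-] Vq] VB].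
have [||_ [[a Aa <-] Va]] := Fq (val_beta @` A) V.
- by apply: (@filterS _ F _ A) => // a Aa; exists a.
- exact: open_nbhs_nbhs.
- by exists a; split => //; exact: VB.
Qed.

Let extension (e : X -> beta) (K : topologicalType) (f : X -> K) :
  embedding e -> dense (range e) ->
  (forall i x, val_beta (e x) i = sval i x) ->
  compact [set: K] -> hausdorff_space K -> continuous f ->
  exists2 g : beta -> K, continuous g & forall x, g (e x) = f x.
Proof.
move=> [einj eopen] edense eE cK hK cf.
pose tr (p : beta) : set_system X := filter_from (nbhs p) (fun V => e @^-1` V).
have trP p : ProperFilter (tr p).
  apply: filter_from_proper.
    apply: filter_from_filter; first by exists setT; exact: filterT.
    by move=> V W pV pW; exists (V `&` W) => //; exact: filterI.
  move=> V; rewrite nbhsE => -[W [oW Wp] WV].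
  have [|y [Wy [x _ exy]]] := edense W _ oW; first by exists p.
  by exists x; apply: WV; rewrite exy.
have crK : @completely_regular_space K.
  apply: (@normal_completely_regular R); first exact: compact_normal.
  exact: hausdorff_accessible.
have regK : regular_space K by exact: (@completely_regular_regular R).
have lim_ex p : exists k : K, f @ tr p --> k.
  have [|k [_ pk]] := cK (f @ tr p) _; first exact: filterT.
  exists k; apply: (@compact_cluster_set1 K k (f @ tr p) setT) => //; try exact: filterT.
  apply/seteqP; split => [k' pk'/=|_ -> //]; apply: contrapT => kk'.
  have [g [cg g01 gk gk']] : exists g : K -> R, [/\ continuous g,
      range g `<=` `[0, 1], g @` [set k] `<=` [set 0] &
      g @` [set k'] `<=` [set 1]].
    apply/uniform_separatorP; apply: crK => /=; last by move=> /esym.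
    exact/accessible_closed_set1/hausdorff_accessible.
  have gf : continuous (g \o f) /\ range (g \o f) `<=` `[0, 1].
    split; first by move=> x; apply: continuous_comp; [exact: cf|exact: cg].
    by move=> _ [x _ <-]; apply: g01; exists (f x).
  pose i : cube_index := exist _ (g \o f) gf.
  have gE k0 : cluster (f @ tr p) k0 -> g k0 = val_beta p i.
    move=> pk0; apply: Rhausdorff => A B nA nB.
    have /= nB' := @coord_continuous i p B nB.
    have nA' := cg k0 A nA.
    pose Bi : set beta := (fun q : beta => val_beta q i) @^-1` B.
    have [|_ [[x Bx <-] Afx]] := pk0 (f @` (e @^-1` Bi)) _ _ nA'.
      by exists Bi => // x Bx; exists x.
    by exists (g (f x)); split => //; move: Bx; rewrite /Bi /= eE.
  have : (0 : R) = 1.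
    rewrite -(gk (g k)); last by exists k.
    by rewrite -(gk' (g k')); [rewrite !gE|exists k'].
  by apply/eqP; rewrite eq_sym oner_eq0.
have [g gP] := choice lim_ex.
exists g => [p A|x].
  move=> /regK[B nB clBA]; have [V nV VB] := gP p B nB.
  rewrite /= nbhs_simpl; apply: filterS (nbhs_interior nV) => q qV.
  apply: clBA; have clB : closed (closure B) by exact: closed_closure.
  apply: (@closed_cvg X K (tr q) _ f (closure B) clB _ (g q) (gP q)).
  by exists V => // x Vx; apply: subset_closure; exact: VB.
apply: (cvg_unique _ (gP (e x))) => // A nA.
have := cf x A nA; rewrite /= nbhs_simpl nbhsE => -[U [oU Ux] UA].
have [V oV VU] := (eopen U).1 oU; exists V => [|y Vy /=].
  by apply: open_nbhs_nbhs; split => //; move: Ux; rewrite -VU.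
by apply: UA; rewrite -VU.
Qed.

Lemma stone_cech_exists : completely_regular_space X -> hausdorff_space X ->
  exists (bX : topologicalType) (e : X -> bX), stone_cech e.
Proof.
move=> crX hX.
have cts (i : cube_index) : continuous (sval i) by case: (svalP i).
have sep : separate_points_from_closed (fun i : cube_index => sval i).
  move=> U x cU Ux.
  have /(@uniform_separatorP X R)[g [cg g01 g0 g1]] := crX x U cU Ux.
  exists (exist _ g (conj cg g01)) => /=.
  have g1' : closure (g @` U) `<=` [set 1].
    rewrite [X in _ `<=` X](closure_id _).1; first exact: closureS.
    exact/accessible_closed_set1/hausdorff_accessible/Rhausdorff.
  rewrite (g0 (g x)); last by exists x.
  by move=> /g1' /= /eqP; rewrite eq_sym oner_eq0.
have inj : set_inj [set: X] ev.
  by apply: join_product_inj => //; exact: hausdorff_accessible.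
have emb : embedding ev_beta.
  split=> [x y /(congr1 sval)/inj|U]; first by apply; rewrite inE.
  rewrite (join_product_initial sep cts inj); split=> [[V oV <-]|[V]].
    by exists (val_beta @^-1` V) => //; exists V.
  by move=> [W oW <-] <-; exists W.
have dns : dense (range ev_beta).
  move=> O [[q clq] Oq] [V oV VE]; move: Oq; rewrite -VE => /= Vq.
  have [|_ [[x _ <-] Vx]] := set_mem clq V; first exact: open_nbhs_nbhs.
  by exists (ev_beta x); split => //; exists x.
by exists beta, ev_beta; split => // K f; exact: extension.
Qed.

End StoneCechExists.

(* Main.v *)
Require Import Defs.
From mathcomp Require Import all_boot all_order all_algebra.
From mathcomp Require Import all_classical all_reals.
From mathcomp Require Import topology normedtype.

(** All four conditions say that the whole space X is null.

    For the two function algebras, local nullity and complete regularity give,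
    at each point, a function of [C00] (hence of [C0]) which does not vanish
    there ([C00_nonvanishing]).  A unit u satisfies u f = f for all f in the
    algebra, so it must be the constant function 1 ([unital_cst1]); and the
    constant function 1 lies in [C0] or [C00] exactly when X, which is both its
    support and the set where it is at least 1, has a null neighborhood, that
    is, when X is null ([null_setT]).

    For [lambda], if X is null then C = X is one of the cozero-sets in the
    union, so that [lambda] is the whole of the compactification.  Conversely,
    when X is not null, the complements of the null sets generate a proper
    filter on X, because a null join contains the union of two null sets
    ([null_directed]).  The set [lambda] belongs to the image of this filter,
    since it contains X ([range_sub_lambda]), but the filter has no cluster
    point there: a point of [lambda] has a neighborhood whose trace on X lies in
    a null set
    ([compact_lambda_null]). *)

Import Order.TTheory GRing.Theory Num.Theory.
Import numFieldNormedType.Exports.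

Local Open Scope classical_set_scope.
Local Open Scope ring_scope.

Section NullSets.
Context {X : topologicalType} (L I : set (set X)).

Lemma has_null_nbhdS (A B : set X) :
  A `<=` B -> has_null_nbhd I B -> has_null_nbhd I A.
Proof. by move=> AB [U IU BU]; exists U => // x /AB/BU. Qed.

(** The ideal is closed under subsets only within L, but the only neighborhood
    of X is X itself. *)
Lemma null_setT : I [set: X] <-> has_null_nbhd I [set: X].
Proof.
split=> [IX|[U IU XU]]; first by exists [set: X]; rewrite // interiorT.
suff -> : [set: X] = U by [].
by apply/seteqP; split=> // x /XU/interior_subset.
Qed.

Lemma null_directed : upper_semilattice L -> ideal L I ->
  forall U V, I U -> I V -> exists2 W, I W & U `|` V `<=` W.
Proof.
move=> joinL [IL _ Ijoin _] U V IU IV.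
have [W jW] := joinL _ _ (IL _ IU) (IL _ IV).
exists W; first exact: Ijoin jW.
by case: jW => _ UW VW _; rewrite subUset.
Qed.

End NullSets.

Section Algebras.
Context {R : realType} {X : topologicalType} (I : set (set X)).

Lemma C00_sub_C0 : C00 R I `<=` C0 R I.
Proof.
move=> f [Cbf nf]; split=> // n n0; apply: has_null_nbhdS nf => x /= fx.
apply: subset_closure => /= fx0; move: fx; rewrite fx0 normr0.
by rewrite leNgt invr_gt0 ltr0n n0.
Qed.

(** The separating function g vanishes at x and is 1 off the interior of a null
    neighborhood; cutting it at height 1/2, rather than taking 1 - g, keeps the closure of
    the cozero-set inside that neighborhood. *)
Lemma C00_nonvanishing : completely_regular_space X -> locally_null I ->
  forall x, exists2 f, C00 R I f & f x != 0.
Proof.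
move=> crX nX x; have [U IU xU] := nX x.
have cU : closed (~` U°) by apply: open_closedC; exact: open_interior.
have /uniform_separatorP -/(_ R)[g [cg g01 gx gU]] :
    uniform_separator [set x] (~` U°).
  by apply: crX => //; apply; exact: xU.
have g0 : g x = 0 by apply: gx; exists x.
have gI y : 0 <= g y <= 1.
  by have /= := g01 (g y) (ex_intro2 _ _ y Logic.I erefl); rewrite in_itv.
pose f : X -> R := (fun y => 2^-1 - g y) \max (fun=> 0).
have cf : continuous f.
  move=> y; apply: continuous_max; last exact: cst_continuous.
  by apply: cvgB; [exact: cvg_cst|exact: cg].
exists f; last by rewrite /f /= g0 subr0 gt_eqF// lt_max invr_gt0 ltr0n.
split.
  split=> //; exists 1; split=> // M M1 y _ /=.
  have [g_ge0 _] := andP (gI y).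
  rewrite ger0_norm ?le_max ?lexx ?orbT// (le_trans _ (ltW M1))// ge_max ler01.
  by rewrite andbT lerBlDr (le_trans (y := 1)) ?invf_le1 ?ler1n ?lerDl.
exists U => //.
have cl : closed (g @^-1` [set t | t <= 2^-1]).
  by apply: closed_comp; [move=> y _; exact: cg|exact: closed_le].
have : supp f `<=` g @^-1` [set t | t <= 2^-1].
  rewrite [X in _ `<=` X](closure_id _).1 //; apply: closureS => y /= fy.
  rewrite leNgt; apply/negP => gy; apply: fy => /=.
  by apply/max_idPr; rewrite subr_le0 ltW.
move=> /subset_trans; apply => y /= gy; apply: contrapT => nUy.
have gy1 : g y = 1 by apply: gU; exists y.
by move: gy; rewrite gy1 leNgt invf_lt1 ?ltr1n.
Qed.

Lemma unital_cst1 (A : set (X -> R)) :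
  (forall x, exists2 f, A f & f x != 0) -> unital A <-> A (fun=> 1).
Proof.
move=> nz; split=> [[u Au uP]|A1]; last first.
  by exists (fun=> 1) => // f _; split; apply/funext => x /=;
    rewrite (mul1r, mulr1).
suff <- : u = (fun=> 1) by [].
apply/funext => x; have [f Af fx0] := nz x.
apply: (mulIf fx0); rewrite mul1r.
by have [/(congr1 (@^~ x))] := uP f Af.
Qed.

Lemma Cb_cst1 : Cb (fun=> 1 : R) (X := X).
Proof.
split; first exact: cst_continuous.
by exists 1; split=> // M M1 y _ /=; rewrite normr1 ltW.
Qed.

Lemma coz_cst1 : coz (fun=> 1 : R) = [set: X].
Proof.
by apply/seteqP; split=> // x _ /= /eqP; rewrite oner_eq0.
Qed.

Lemma C00_cst1 : C00 R I (fun=> 1) <-> I [set: X].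
Proof.
rewrite null_setT /C00 /= /supp coz_cst1 closureT.
by split=> [[]//|nX]; split=> //; exact: Cb_cst1.
Qed.

Lemma C0_cst1 : C0 R I (fun=> 1) <-> I [set: X].
Proof.
split=> [[_ /(_ 1 isT)]|/C00_cst1/C00_sub_C0//].
by move=> n1; apply/null_setT; apply: has_null_nbhdS n1 => x _ /=;
  rewrite invr1 normr1.
Qed.

End Algebras.

Section Embedding.
Context {X bX : topologicalType} {e : X -> bX}.

Lemma embedding_preimage_closure (C : set X) :
  embedding e -> e @^-1` closure (e @` C) `<=` closure C.
Proof.
move=> [_ eopen] x clx B; rewrite nbhsE => -[U [oU Ux] UB].
have [V oV VU] := (eopen U).1 oU.
have [|_ [[y Cy <-] Vy]] := clx V.
  by apply: open_nbhs_nbhs; split=> //; move: Ux; rewrite -VU.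
by exists y; split=> //; apply: UB; rewrite -VU.
Qed.

(** With C the trace of an open set V, density of the image makes V a subset of
    the closure of its trace, so that V witnesses interiority. *)
Lemma dense_embedding_interior_closure (C : set X) :
  embedding e -> dense (range e) -> open C ->
  e @` C `<=` (closure (e @` C))°.
Proof.
move=> [_ eopen] edense oC _ [x Cx <-].
have [V oV VC] := (eopen C).1 oC.
have Vx : V (e x) by move: Cx; rewrite -VC.
rewrite /interior nbhsE; exists V => // z Vz B.
rewrite nbhsE => -[W [oW Wz] WB].
have [|q [[Vq Wq] [y _ ey]]] := edense (V `&` W) _ (openI oV oW).
  by exists z.
exists q; split; last exact: WB.
rewrite -ey in Vq *.
by exists y => //; rewrite -VC.
Qed.

End Embedding.

Section Lambda.
Context {R : realType} {X bX : topologicalType} {e : X -> bX}.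
Context (L I : set (set X)).

Lemma open_coz (f : X -> R) : continuous f -> open (coz f).
Proof.
move=> cf; apply: closed_openC; apply: closed_comp => [y _|]; first exact: cf.
exact/accessible_closed_set1/hausdorff_accessible/Rhausdorff.
Qed.

Lemma range_sub_lambda : completely_regular_space X -> locally_null I ->
  embedding e -> dense (range e) -> range e `<=` lambda R e I.
Proof.
move=> crX nX emb edense _ [x _ <-].
have [f [[cf _] nf] fx0] := @C00_nonvanishing R X I crX nX x.
exists (coz f); first by split=> //; exists f.
apply: dense_embedding_interior_closure => //; first exact: open_coz.
by exists x => //; exact/eqP.
Qed.

Lemma lambda_null : embedding e -> dense (range e) -> I [set: X] ->
  lambda R e I = [set: bX].
Proof.
move=> emb edense IX; apply/seteqP; split=> // p _.
exists [set: X]; last first.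
  suff -> : closure (range e) = [set: bX] by rewrite interiorT.
  apply/seteqP; split=> // q _ B; rewrite nbhsE => -[W [oW Wq] WB].
  have [|y [Wy ey]] := edense W _ oW; first by exists q.
  by exists y; split=> //; exact: WB.
split; last by rewrite closureT; exact: (null_setT I).1.
by exists (fun=> 1); [exact: cst_continuous|exact: coz_cst1].
Qed.

(** Clustering the filter of complements of null sets plays the part of a finite
    subcover of [lambda] by the sets of its defining union: finite unions of
    null sets are absorbed in the directedness of I. *)
Lemma compact_lambda_null : upper_semilattice L -> ideal L I ->
  embedding e -> range e `<=` lambda R e I ->
  compact (lambda R e I) -> I [set: X].
Proof.
move=> joinL idI emb eX cl; apply: contrapT => nIX.
pose F := filter_from I (fun U => e @` (~` U)).
have FF : ProperFilter F.
  apply: filter_from_proper.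
    apply: filter_from_filter; first by case: idI.
    move=> U V IU IV; have [W IW UVW] := null_directed _ _ joinL idI _ _ IU IV.
    by exists W => // _ [x Wx <-]; split; exists x => // ?; apply: Wx;
      apply: UVW; [left|right].
  move=> U IU; apply: contrapT => U0; apply: nIX.
  suff -> : [set: X] = U by [].
  apply/seteqP; split=> // x _; apply: contrapT => Ux; apply: U0.
  by exists (e x); exists x.
have [|p [[C [_ [U IU CU]] Cp] Fp]] := cl F FF.
  have [_ [U IU] _ _] := idI.
  by exists U => // _ [x _ <-]; apply: eX; exists x.
(* The filter set e(X \ U) must meet the neighborhood of p attached to C,
   whose trace on X is contained in the closure of C, hence in U. *)
have [||_ [[x nUx <-] clx]] := Fp (e @` (~` U)) (closure (e @` C)).
- by exists U.
- exact: Cp.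
apply: nUx; apply: interior_subset; apply: CU.
exact: embedding_preimage_closure emb _ clx.
Qed.

End Lambda.

Theorem theorem3p7 (R : realType) (X bX : topologicalType) (e : X -> bX)
    (L I : set (set X)) :
  completely_regular_space X -> hausdorff_space X ->
  stone_cech e ->
  upper_semilattice L -> ideal L I ->
  locally_null I ->
  [<-> compact (lambda R e I);
       I [set: X];
       unital (C0 R I);
       unital (C00 R I)].
Proof.
move=> crX _ [cbX _ emb edense _] joinL idI nX.
have nz00 := @C00_nonvanishing R X I crX nX.
have nz0 x : exists2 f, C0 R I f & f x != 0.
  by have [f /C00_sub_C0 ? ?] := nz00 x; exists f.
tfae.
- by apply: (compact_lambda_null _ _ joinL idI emb); exact: range_sub_lambda.
- by move=> IX; apply/unital_cst1/C0_cst1.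
- by move=> /(unital_cst1 _ nz0)/C0_cst1/C00_cst1 ?; exact/unital_cst1.
- by move=> /(unital_cst1 _ nz00)/C00_cst1 IX; rewrite lambda_null.
Qed.
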